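(* Let $I=[a,b]\subset\mathbb{R}$ with $a<b$, let $x_a\in\mathbb{R}$ and let $f:I\times\mathbb{R}\to\mathbb{R}$. The initial value problem $$x'=f(t,x)\ \text{ for a.a. } t\in I,\qquad x(a)=x_a,$$ has at least one absolutely continuous solution $x:I\to\mathbb{R}$ provided that $f$ satisfies the following conditions: (H1) There exists $M\in L^1(I,[0,\infty))$ such that $|f(t,x)|\le M(t)$ for a.a. $t\in I$ and all $x\in\mathbb{R}$. (H2) For every $x\in\mathcal{C}(I)$ the composition $t\in I\mapsto f(t,x(t))$ is measurable. (H3) There exist admissible discontinuity curves $\gamma_n:I_n=[a_n,b_n]\to\mathbb{R}$ ($n\in\mathbb{N}$) for the differential equation $x'=f(t,x)$ such that for a.a. $t\in I$ the function $x\mapsto f(t,x)$ is continuous on $\mathbb{R}\setminus\bigcup_{\{n:\,t\in I_n\}}\{\gamma_n(t)\}$.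
   Context: An admissible discontinuity curve for the differential equation $x'=f(t,x)$ is an absolutely continuous function $\gamma:[c,d]\subset I\to\mathbb{R}$ satisfying one of the following conditions: either (viable) $\gamma'(t)=f(t,\gamma(t))$ for a.a. $t\in[c,d]$; or (inviable) there exist $\varepsilon>0$ and $\psi\in L^1(c,d)$, $\psi(t)>0$ for a.a. $t\in[c,d]$, such that either $$\gamma'(t)+\psi(t)<f(t,y)\quad\text{for a.a. }t\in[c,d]\text{ and all }y\in[\gamma(t)-\varepsilon,\gamma(t)+\varepsilon],$$ or $$\gamma'(t)-\psi(t)>f(t,y)\quad\text{for a.a. }t\in[c,d]\text{ and all }y\in[\gamma(t)-\varepsilon,\gamma(t)+\varepsilon].$$ $\mathcal{C}(I)$ is the space of continuous real functions on $I$; ''a.a.'' and measurability are with respect to Lebesgue measure. *)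

(* Defs.v *)
From HB Require Import structures.
From mathcomp Require Import all_boot all_order all_algebra.
From mathcomp Require Import all_classical all_reals all_analysis.

Set Implicit Arguments.
Unset Strict Implicit.
Unset Printing Implicit Defensive.

Import Order.TTheory GRing.Theory Num.Theory.
Import numFieldNormedType.Exports.

Local Open Scope classical_set_scope.
Local Open Scope ring_scope.

(* The real line with the Lebesgue-measurable (not only Borel) sets, that is,
   the domain of [completed_lebesgue_measure]. *)
Definition lebesgueTypeR (R : realType) : measurableType _ :=
  caratheodory_type ((@wlength R idfun)^*)%mu.

Definition lebesgue_measurable_fun (R : realType) (D : set R) (g : R -> R) :=
  @measurable_fun _ _ (lebesgueTypeR R) R D g.

Definition L1 (R : realType) (D : set R) (g : R -> R) :=
  (@completed_lebesgue_measure R).-integrable D (EFin \o g).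

Definition ae_on (R : realType) (D : set R) (P : R -> Prop) :=
  {ae @completed_lebesgue_measure R, forall t, D t -> P t}.

(* A function on [c, d] is represented by a function on R of which only the
   values on [c, d] matter. *)
Definition absolutely_continuous (R : realType) (c d : R) (g : R -> R) :=
  forall e : R, 0 < e -> exists2 delta : R, 0 < delta &
    forall (n : nat) (u v : 'I_n -> R),
      (forall i, [/\ c <= u i, u i < v i & v i <= d]) ->
      trivIset [set: 'I_n] (fun i => `]u i, v i[%classic) ->
      \sum_(i < n) (v i - u i) < delta ->
      \sum_(i < n) `|g (v i) - g (u i)| < e.

Definition caratheodory_solution (R : realType) (f : R -> R -> R)
    (c d : R) (x : R -> R) :=
  ae_on `[c, d] (fun t => is_derive t 1 x (f t (x t))).

Definition inviable (R : realType) (f : R -> R -> R)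
    (c d : R) (gamma : R -> R) :=
  exists (eps : R) (psi : R -> R),
    [/\ 0 < eps,
        L1 `]c, d[ psi,
        ae_on `[c, d] (fun t => 0 < psi t) &
        ae_on `[c, d] (fun t => derivable gamma t 1 /\
          forall y : R, y \in `[gamma t - eps, gamma t + eps] ->
            derive1 gamma t + psi t < f t y)
        \/
        ae_on `[c, d] (fun t => derivable gamma t 1 /\
          forall y : R, y \in `[gamma t - eps, gamma t + eps] ->
            derive1 gamma t - psi t > f t y)].

Definition admissible_curve (R : realType) (a b : R) (f : R -> R -> R)
    (c d : R) (gamma : R -> R) :=
  [/\ [/\ a <= c, c <= d & d <= b],
      absolutely_continuous c d gamma &
      caratheodory_solution f c d gamma \/ inviable f c d gamma].

(* Main.v *)
Require Import Defs.
From HB Require Import structures.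
From mathcomp Require Import all_boot all_order all_algebra.
From mathcomp Require Import all_classical all_reals all_analysis.
From mathcomp Require Import measurable_realfun ring lra.

(** The proof is a compactness argument that produces a candidate solution,
    followed by a pointwise identification of its derivative.

    Candidate. Since [f] may be discontinuous in the state, the superposition
    [y |-> f(., y(.))] is not continuous and no fixed point theorem applies
    directly. The delayed equations
      [y_k(t) = xa + int_a^(t - h_k) f(r, y_k(r)) dr], with [h_k -> 0],
    need no fixed point at all: each one is solved by marching along [a, b] in
    steps of length [h_k] ([delayed_solution]). By (H1) the primitives
    [int_a^t f(r, y_k(r)) dr] share the modulus of continuity of [int M], hence
    a subsequence converges pointwise to some [u]
    ([pointwise_convergent_subsequence]), and then [y_k -> x := xa + u] too.

    Identification. The increments of [u] are dominated by those of [int M], so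
    [u] is itself a primitive by Radon-Nikodym ([dominated_is_primitive]), and
    in particular it is differentiable a.e. Comparing [u] with the primitives
    of [sup_(j >= m) f(., y_j(.))] and of the corresponding infima gives, a.e.,
      [liminf f(t, y_k(t)) <= x'(t) <= limsup f(t, y_k(t))]
    ([ae_derive_limit_of_primitives]). Three cases remain for such a [t].
    - If [f t] is continuous at [x t], both bounds equal [f t (x t)]
      ([slope_at_continuity_point]).
    - Otherwise [x t = gamma_n t] for some [n]. The isolated points of the
      contact set [x = gamma_n] are countably many, so [t] may be assumed to be
      a limit point of it, whence [x'(t) = gamma_n'(t)]
      ([is_derive_limit_point_eq]). If [gamma_n] is viable, this derivative is
      [f t (gamma_n t) = f t (x t)].
    - If [gamma_n] is inviable, say [gamma_n' + psi < f] near its graph, the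
      lower bound gives [x'(t) >= gamma_n'(t) + psi t > x'(t)], a contradiction:
      contact happens only on a null set ([slope_at_contact]).

    Integration is carried out with the Lebesgue measure on Borel sets; the
    hypotheses, which speak of its completion, are transferred by choosing
    Borel versions of Lebesgue measurable functions. *)

Set Implicit Arguments.
Unset Strict Implicit.
Unset Printing Implicit Defensive.

Import Order.TTheory GRing.Theory Num.Theory.
Import numFieldNormedType.Exports.

Local Open Scope classical_set_scope.
Local Open Scope ring_scope.

#[local] Hint Extern 0 (Filter (nbhs (almost_everywhere lebesgue_measure))) =>
  (exact: (ae_filter_ringOfSetsType lebesgue_measure)) : typeclass_instances.
#[local] Hint Extern 0 (Filter (almost_everywhere lebesgue_measure)) =>
  (exact: (ae_filter_ringOfSetsType lebesgue_measure)) : typeclass_instances.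

(** * Lebesgue measurable functions and their Borel versions *)

Section completed.
Context {R : realType}.

(** A set that is measurable for the completion is the union of a Borel set and
    of a subset of a Borel null set; if it is null, so is its Borel part. *)
Lemma negligible_completed_borel (N : set R) :
  (@completed_lebesgue_measure R).-negligible N <->
  (@lebesgue_measure R).-negligible N.
Proof.
split=> [[A [mA A0 NA]]|[A [mA A0 NA]]]; last first.
  by exists A; split => //; exact: sub_caratheodory.
have : ((@wlength R idfun)^*%mu).-cara.-measurable A by exact: mA.
rewrite -completed_caratheodory_measurable g_sigma_completed_algebra_genE.
move=> -[X mX [Z nZ XZA]].
have X0 : (@lebesgue_measure R) X = 0%E.
  apply/eqP; rewrite -measure_le0 -[leRHS]A0.
  by apply: le_outer_measure; rewrite -XZA; exact: subsetUl.
apply: (@negligibleS _ _ _ (@lebesgue_measure R) A N NA); rewrite -XZA.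
by apply: negligibleU => //; exact/negligibleP.
Qed.

Lemma ae_completed_borel (P : R -> Prop) :
  {ae @completed_lebesgue_measure R, forall t, P t} <->
  {ae @lebesgue_measure R, forall t, P t}.
Proof. exact: negligible_completed_borel. Qed.

(** Each superlevel set [g > q] with [q] rational is Borel up to a null set.
    Setting [g] to zero on the countable union of these null sets makes all
    superlevel sets Borel, since rational levels generate the real ones. *)
Lemma lebesgue_measurable_borel_version (D : set R) (g : R -> R) :
  measurable D -> lebesgue_measurable_fun D g ->
  exists h : R -> R, measurable_fun setT h /\
    {ae @lebesgue_measure R, forall t, D t -> h t = g t}.
Proof.
move=> mD mg.
(* [n] codes a rational level; [XF.1] is the Borel part of the superlevel set
   and [XF.2] a Borel null set containing the rest. *)
have ex (n : nat) : exists XF : set R * set R,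
    [/\ measurable XF.1, measurable XF.2, (@lebesgue_measure R) XF.2 = 0%E &
    forall t, ~ XF.2 t -> XF.1 t <-> D t /\ ratr (odflt 0 (unpickle n)) < g t].
  set q : R := ratr _.
  have mDc : measurable (D : set (lebesgueTypeR R)).
    exact: sub_caratheodory.
  have := mg mDc `]q, +oo[%classic (measurable_itv _).
  set A := _ `&` _ => mA.
  have : ((@wlength R idfun)^*%mu).-cara.-measurable A by exact: mA.
  rewrite -completed_caratheodory_measurable g_sigma_completed_algebra_genE.
  move=> -[X mX [Z [F [mF F0 ZF]] XZA]]; exists (X, F); split => //= t Ft.
  have -> : X t <-> A t.
    rewrite -XZA; split => [|[//|/ZF//]]; by left.
  by rewrite /A /= in_itv/= andbT.
have [XF HXF] := choice ex.
pose F := \bigcup_n (XF n).2.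
have mF : measurable F by apply: bigcupT_measurable => n; have [] := HXF n.
have nF : (@lebesgue_measure R).-negligible F.
  by apply: negligible_bigcup => n; have [? ? ? ?] := HXF n; exact/negligibleP.
exists (g \_ (D `\` F)); split; last first.
  apply: (negligibleS _ nF) => t /=; apply: contra_notP => nFt Dt.
  by rewrite patchE mem_set.
have mDF : measurable (D `\` F) by exact: measurableD.
apply/(measurable_restrictT _ mDF).
apply: (measurability _ (RGenOInfty.measurableE R)) => //.
move=> _ [_ [r ->] <-].
rewrite (_ : _ `&` _ = \bigcup_(n in [set n | r <= ratr (odflt 0%R (unpickle n)) :> R])
    ((XF n).1 `\` F)).
  by apply: bigcup_measurable => n _; apply: measurableD => //; have [] := HXF n.
apply/seteqP; split=> [t [[Dt Ft]]|t [n /= rn [Xt Ft]]].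
  rewrite /= in_itv/= andbT => /rat_in_itvoo[q].
  rewrite in_itv/= => /andP[rq qg].
  exists (pickle q); first by rewrite /= pickleK/= ltW.
  split=> //; have [_ _ _ H] := HXF (pickle q).
  apply/H; first by move=> Ht; apply: Ft; exists (pickle q).
  by rewrite pickleK.
have [_ _ _ H] := HXF n.
have [|Dt gt] := (H t _).1 Xt; first by move=> Ht; apply: Ft; exists n.
by split => //=; rewrite in_itv/= andbT (le_lt_trans rn).
Qed.

(** The Borel measure is the push-forward of the completed one under the
    identity. *)
Lemma integral_completed_borel (h : R -> \bar R) :
  measurable_fun setT h -> (forall t, (0 <= h t)%E) ->
  (\int[@completed_lebesgue_measure R]_t h t =
   \int[@lebesgue_measure R]_t h t)%E.
Proof.
move=> mh h0.
have mid : @measurable_fun _ _ (lebesgueTypeR R) (measurableTypeR R) setT id.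
  by move=> _ A mA; rewrite setTI; exact: sub_caratheodory.
have := @ge0_integral_pushforward _ _ (lebesgueTypeR R) (measurableTypeR R) R _ mid
  (@completed_lebesgue_measure R) setT h measurableT mh (fun y _ => h0 y).
by move=> /= <-.
Qed.

Lemma L1_borel_version (D : set R) (g : R -> R) : measurable D -> L1 D g ->
  exists h : R -> R, (@lebesgue_measure R).-integrable setT (EFin \o h) /\
    {ae @lebesgue_measure R, forall t, D t -> h t = g t}.
Proof.
move=> mD /integrableP[mg ig].
have mDc : measurable (D : set (lebesgueTypeR R)) by exact: sub_caratheodory.
have mg' : lebesgue_measurable_fun D g by exact/measurable_EFinP.
have [h [mh hg]] := lebesgue_measurable_borel_version mD mg'.
have mhD : measurable_fun setT (h \_ D).
  by apply/(measurable_restrictT _ mD); exact: measurable_funTS.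
exists (h \_ D); split; last first.
  by apply: filterS hg => t + Dt; rewrite patchE mem_set//; exact.
apply/integrableP; split; first exact/measurable_EFinP.
rewrite -integral_completed_borel//; last first.
  exact/measurableT_comp/measurable_EFinP.
rewrite [ltLHS](_ : _ =
    \int[@completed_lebesgue_measure R]_(t in D) `|(h t)%:E|)%E; last first.
  rewrite [RHS]integral_mkcond; apply: eq_integral => t _.
  by rewrite /= !patchE; case: ifP => //; rewrite normr0.
apply: le_lt_trans ig; rewrite le_eqVlt; apply/orP; left; apply/eqP.
apply: ae_eq_integral; first exact: mDc.
- apply/measurable_EFinP; apply: measurableT_comp => //.
  move=> _ A mA; apply: measurableI => //; apply: sub_caratheodory.
  by have := mh measurableT A mA; rewrite setTI.
- exact: measurableT_comp.
- move/ae_completed_borel : hg; apply: negligibleS => t /=.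
  by apply: contra_not => /[apply] ->.
Qed.

End completed.

(** * Primitives of integrable functions *)

Section primitive.
Context {R : realType}.
Notation mu := (@lebesgue_measure R).
Notation integrable g := (mu.-integrable setT (EFin \o g)).
Implicit Types (f g M x : R -> R) (s t : R).

Definition prim g t := \int[mu]_(r in `]-oo, t]) g r.

Lemma primB g s t : integrable g -> s <= t ->
  prim g t - prim g s = \int[mu]_(r in `]s, t]) g r.
Proof.
move=> ig st; rewrite /prim Rintegral_itvB//.
exact: integrableS ig.
Qed.

Lemma prim_le f g s t : integrable f -> integrable g ->
  (forall r, f r <= g r) -> s <= t ->
  prim f t - prim f s <= prim g t - prim g s.
Proof.
move=> If Ig fg st; rewrite !primB//; apply: le_Rintegral => //.
- exact: integrableS If.
- exact: integrableS Ig.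
Qed.

Lemma integrableN_EFin g : integrable g -> integrable (\- g).
Proof. by move=> /integrableN; apply: eq_integrable => // t _ /=; rewrite EFinN. Qed.

Lemma primN g t : integrable g -> prim (\- g) t = - prim g t.
Proof.
move=> ig; rewrite /prim -[RHS]mulN1r -RintegralZl//.
  by apply: eq_Rintegral => r _; rewrite mulN1r.
exact: integrableS ig.
Qed.

Lemma prim_dominated g M s t : integrable g -> integrable M ->
  (forall r, `|g r| <= M r) -> s <= t ->
  `|prim g t - prim g s| <= prim M t - prim M s.
Proof.
move=> ig iM gM st; rewrite ler_norml; apply/andP; split.
  rewrite lerNl opprB.
  have := prim_le (integrableN_EFin ig) iM _ st.
  rewrite !primN// opprK addrC; apply => r.
  by have := gM r; rewrite ler_norml lerNl => /andP[].
by apply: prim_le => // r; have := gM r; rewrite ler_norml => /andP[].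
Qed.

Lemma prim_nondecreasing M s t : integrable M -> (forall t, 0 <= M t) ->
  s <= t -> prim M s <= prim M t.
Proof.
move=> iM M0 st; rewrite -subr_ge0; apply: le_trans (prim_dominated iM iM _ st) => //.
by move=> r; rewrite ger0_norm.
Qed.

Lemma prim_unif_continuous M (e : R) : integrable M ->
  (forall t, 0 <= M t) -> 0 < e ->
  exists2 d : R, 0 < d & forall s t, `|t - s| < d -> `|prim M t - prim M s| < e.
Proof.
move=> iM M0 e0; have [d [d0 H]] := integral_normr_continuous iM e0.
exists d => //.
suff G s t : s <= t -> `|t - s| < d -> `|prim M t - prim M s| < e.
  move=> s t; have [|/ltW] := leP s t; first exact: G.
  by move=> /G; rewrite distrC (distrC (prim M s)).
move=> st; rewrite [`|t - s|]ger0_norm ?subr_ge0// => td; rewrite primB//.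
have mst : measurable `]s, t]%classic by exact: measurable_itv.
apply: le_lt_trans (H _ mst _).
  by apply: le_normr_Rintegral => //; exact: integrableS iM.
rewrite /= lebesgue_measure_itv/= lte_fin; case: ifP => _.
  by rewrite -EFinD lte_fin.
by rewrite lte_fin.
Qed.

Lemma prim_ae_derive g : integrable g ->
  {ae mu, forall t, is_derive t 1 (prim g) (g t)}.
Proof.
move=> ig; have ig' y : mu.-integrable `]-oo, y] (EFin \o g).
  exact: integrableS ig.
have lg : locally_integrable setT g.
  by apply: open_integrable_locally => //; exact: openT.
have := FTC1Ny ig' lg; apply: filterS => t [dt gt].
by apply: DeriveDef; [exact: dt|rewrite -derive1E].
Qed.

(** Disjoint intervals of small total length form a set of small measure, over
    which the integral of [M] is small. *)
Lemma absolutely_continuous_dominated x M a b : integrable M ->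
  (forall t, 0 <= M t) ->
  (forall s t, s <= t -> `|x t - x s| <= prim M t - prim M s) ->
  absolutely_continuous a b x.
Proof.
move=> iM M0 xM e e0; have [d [d0 H]] := integral_normr_continuous iM e0.
exists d => // n u v uv tuv sd.
pose F (i : 'I_n) := `]u i, v i[%classic.
have mF i : measurable (F i) by exact: measurable_itv.
pose U := \big[setU/set0]_(i <- index_enum 'I_n) F i.
have mU : measurable U by exact: bigsetU_measurable.
have tF : trivIset [set` index_enum 'I_n] F.
  by apply: sub_trivIset tuv.
have muU : mu U = (\sum_(i < n) (v i - u i))%:E.
  rewrite [LHS]measure_bigsetU_ord//= -sumEFin; apply: eq_bigr => i _.
  by rewrite lebesgue_measure_itv/= lte_fin; have [_ -> _] := uv i; rewrite -EFinD.
have Ud : (mu U < d%:E)%E by rewrite muU lte_fin.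
have {}H : \int[mu]_(r in U) `|M r| < e by exact: H mU Ud.
apply: le_lt_trans H; rewrite -lee_fin /Rintegral fineK; last first.
  apply: integrable_fin_num => //.
  by apply: integrableS (integrable_abse iM).
have mM : measurable_fun setT (EFin \o M) by case/integrableP : iM.
have mMU : measurable_fun U (fun r => `|M r|%:E).
  apply: measurable_funTS; apply/measurable_EFinP; apply: measurableT_comp => //.
  exact/measurable_EFinP.
have := @ge0_integral_bigsetU _ _ _ mu _ F (fun r => `|M r|%:E) _ mF
  (index_enum_uniq _) tF mMU (fun r _ => normr_ge0 (M r)).
move=> /= ->.
rewrite -sumEFin; apply: lee_sum => i _; have [_ ui_vi _] := uv i.
apply: (@le_trans _ _ (prim M (v i) - prim M (u i))%:E).
  by rewrite lee_fin; exact/xM/ltW.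
rewrite primB ?(ltW ui_vi)// -Rintegral_itv_bndo_bndc; last first.
  exact: integrableS iM.
rewrite /Rintegral fineK.
  rewrite le_eqVlt; apply/orP; left; apply/eqP; apply: eq_integral => r _.
  by rewrite ger0_norm.
by apply: integrable_fin_num => //; exact: integrableS iM.
Qed.

Lemma stieltjes_measure_exists (F : R -> R) :
  {homo F : s t / s <= t} -> continuous F ->
  exists c : cumulative R R, forall s t, s <= t ->
    lebesgue_stieltjes_measure c `]s, t]%classic = (F t - F s)%:E.
Proof.
move=> ndF cF.
pose m := isCumulative.Build _ _ _ F ndF (right_continuousW cF).
exists (HB.pack F m : cumulative R R) => s t st.
rewrite /lebesgue_stieltjes_measure/= /measure_extension.
by rewrite measurable_mu_extE//= ?wlength_itv_bnd//; exact: is_ocitv.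
Qed.

End primitive.

(** * A function dominated by a primitive is a primitive *)

Section dominated.
Context {R : realType}.
Notation mu := (@lebesgue_measure R).
Notation integrable g := (mu.-integrable setT (EFin \o g)).
Implicit Types (g M x : R -> R) (s t : R).

Lemma continuous_dominated x M : integrable M -> (forall t, 0 <= M t) ->
  (forall s t, s <= t -> `|x t - x s| <= prim M t - prim M s) -> continuous x.
Proof.
move=> iM M0 xM t; apply/cvgrPdist_lt => e e0.
have [d d0 H] := prim_unif_continuous iM M0 e0.
near=> s; have st : `|t - s| < d by near: s; exact: cvgr_dist_lt.
apply: le_lt_trans (H _ _ st); have [ts|/ltW ts] := leP s t.
  by rewrite (le_trans (xM _ _ ts))// ler_norm.
by rewrite distrC (distrC (prim M t)) (le_trans (xM _ _ ts))// ler_norm.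
Unshelve. all: by end_near. Qed.

(** The function [prim M - f] is nondecreasing too and, by uniqueness of the
    extension from intervals, its Stieltjes measure added to that of [f] gives
    the measure [M dr]. *)
Lemma dominated_stieltjes_le (f : R -> R) (F : cumulative R R) M : integrable M ->
  (forall t, 0 <= M t) -> continuous f ->
  (forall s t, s <= t -> f t - f s <= prim M t - prim M s) ->
  (forall s t, s <= t ->
    lebesgue_stieltjes_measure F `]s, t]%classic = (f t - f s)%:E) ->
  forall A, measurable A ->
    (lebesgue_stieltjes_measure F A <= \int[mu]_(r in A) (M r)%:E)%E.
Proof.
move=> iM M0 cf fM FE A mA.
have mM : measurable_fun setT (EFin \o M) by case/integrableP : iM.
have cM : continuous (prim M).
  apply: (continuous_dominated iM) => // s t st.
  by apply: prim_dominated => // r; rewrite ger0_norm.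
have [|t|G GE] := @stieltjes_measure_exists _ (prim M \- f).
- by move=> s t st /=; have := fM _ _ st; lra.
- by apply: cvgB; [exact: cM|exact: cf].
have [s t|//|H HE] := @stieltjes_measure_exists _ (prim M).
  exact: prim_nondecreasing.
have H1 : lebesgue_stieltjes_measure H A =
    measure_add (lebesgue_stieltjes_measure F) (lebesgue_stieltjes_measure G) A.
  apply: lebesgue_stieltjes_measure_unique => // X /ocitvP[->|[[s t] /= st ->]].
    by rewrite !measure0.
  have {}st := ltW st.
  transitivity (lebesgue_stieltjes_measure F `]s, t]%classic +
    lebesgue_stieltjes_measure G `]s, t]%classic)%E; last exact/esym/measure_addE.
  by rewrite HE// GE// FE//= -EFinD; congr EFin; lra.
pose nu0 B := (\int[mu]_(r in B) (M r)%:E)%E.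
have nu00 : nu0 set0 = 0%E by rewrite /nu0 integral_set0.
have nu0_ge0 B : (0 <= nu0 B)%E by apply: integral_ge0 => r _; rewrite lee_fin.
have nu0_sigma : semi_sigma_additive nu0.
  by apply: semi_sigma_additive_nng_induced => // r; rewrite lee_fin.
pose m := isMeasure.Build _ (measurableTypeR R) R nu0 nu00 nu0_ge0 nu0_sigma.
pose nu : {measure set (measurableTypeR R) -> \bar R} := HB.pack nu0 m.
have H2 : lebesgue_stieltjes_measure H A = nu A.
  apply: lebesgue_stieltjes_measure_unique => // X /ocitvP[->|[[s t] /= st ->]].
    by rewrite !measure0.
  have {}st := ltW st.
  rewrite HE// primB// /nu/= /nu0 /Rintegral.
  by rewrite fineK//; apply: integrable_fin_num => //; exact: integrableS iM.
rewrite -[leRHS]/(nu A) -H2 H1.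
by rewrite [leRHS](measure_addE (lebesgue_stieltjes_measure F)) leeDl.
Qed.

(** Radon-Nikodym for the Stieltjes measure of the nondecreasing function
    [prim M + x], which is at most [2 M dr], hence finite and absolutely
    continuous. *)
Lemma dominated_is_primitive x M : integrable M -> (forall t, 0 <= M t) ->
  (forall s t, s <= t -> `|x t - x s| <= prim M t - prim M s) ->
  exists2 g, integrable g &
    forall s t, s <= t -> x t - x s = prim g t - prim g s.
Proof.
move=> iM M0 xM.
have iM2 : integrable (M \+ M) by apply: eq_integrable (integrableD measurableT iM iM).
have M20 t : 0 <= (M \+ M) t by rewrite addr_ge0.
have cx := continuous_dominated iM M0 xM.
have cM : continuous (prim M).
  apply: (continuous_dominated iM) => // s t st.
  by apply: prim_dominated => // r; rewrite ger0_norm.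
have primM2 s t : s <= t -> prim (M \+ M) t - prim (M \+ M) s =
    (prim M t - prim M s) + (prim M t - prim M s).
  move=> st; rewrite (primB iM2 st) (primB iM st).
  by apply: RintegralD => //; exact: integrableS iM.
have cF : continuous (prim M \+ x).
  by move=> t; apply: cvgD; [exact: cM|exact: cx].
have [|//|F FE] := @stieltjes_measure_exists _ (prim M \+ x).
  by move=> s t st /=; have := xM _ _ st; rewrite ler_norml => /andP[]; lra.
have Fle A : measurable A ->
    (lebesgue_stieltjes_measure F A <= \int[mu]_(r in A) ((M \+ M) r)%:E)%E.
  apply: (dominated_stieltjes_le iM2 M20 cF _ FE) => s t st; rewrite primM2//=.
  by have := xM _ _ st; rewrite ler_norml => /andP[]; lra.
have finF : fin_num_fun (lebesgue_stieltjes_measure F).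
  move=> A mA; rewrite ge0_fin_numE//.
  apply: le_lt_trans (Fle _ mA) _; rewrite -ge0_fin_numE; last first.
    by apply: integral_ge0 => r _; rewrite lee_fin.
  by apply: integrable_fin_num => //; exact: integrableS iM2.
pose m := Measure_isFinite.Build _ (measurableTypeR R) R
  (lebesgue_stieltjes_measure F) finF.
pose nu : {finite_measure set (measurableTypeR R) -> \bar R} :=
  HB.pack (lebesgue_stieltjes_measure F) m.
have dom : nu `<< mu.
  apply/null_content_dominatesP => A mA A0.
  apply/eqP; rewrite -measure_le0; apply: le_trans (Fle _ mA) _.
  rewrite (@null_set_integral _ _ _ mu A)//; apply: measurable_funTS.
  by case/integrableP : iM2.
have [h [h0 hfin ih hE]] := radon_nikodym_sigma_finite dom.
have ifh : integrable (fine \o h).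
  by apply: eq_integrable ih => // r _ /=; rewrite fineK.
exists ((fine \o h) \- M).
  by apply: eq_integrable (integrableB measurableT ifh iM).
move=> s t st; rewrite primB//; last first.
  by apply: eq_integrable (integrableB measurableT ifh iM).
rewrite RintegralB//; [|exact: integrableS ifh|exact: integrableS iM].
rewrite -(primB iM st).
have : nu `]s, t]%classic = (prim M t + x t - (prim M s + x s))%:E by exact: FE.
rewrite hE// => /(congr1 fine) /= E.
suff -> : \int[mu]_(r in `]s, t]) (fine \o h) r =
    prim M t + x t - (prim M s + x s) by lra.
rewrite -E /Rintegral; congr fine; apply: eq_integral => r _ /=.
by rewrite fineK.
Qed.

End dominated.

(** * Derivatives of limits of primitives *)

Section derivatives.
Context {R : realType}.
Implicit Types (f : R -> R) (s t D : R).

Lemma is_derive_quotient f t D (e : R) : is_derive t 1 f D -> 0 < e ->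
  exists2 d : R, 0 < d & forall s, s != t -> `|s - t| < d ->
    `|(f s - f t) / (s - t) - D| < e.
Proof.
move=> [df <-] e0; move/cvgrPdist_lt: df => /(_ _ e0).
rewrite -nbhs_nearE /dnbhs => /nbhs_ballP[d /= d0 H]; exists d => // s st sd.
have := H (s - t); rewrite /ball/= sub0r normrN => /(_ sd).
rewrite subr_eq0 => /(_ st); rewrite distrC.
by rewrite -[(s - t) *: 1]/((s - t) * 1) mulr1 subrK [_ *: _]mulrC.
Qed.

Lemma is_derive_homo_ge0 f t D : {homo f : r s / r <= s} ->
  is_derive t 1 f D -> 0 <= D.
Proof.
move=> ndf df; rewrite leNgt; apply/negP => D0.
have [|d d0 H] := is_derive_quotient df (e := - D); first by rewrite oppr_gt0.
have st : t < t + d / 2 by rewrite ltrDl divr_gt0.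
have := H (t + d / 2); rewrite gt_eqF// (_ : t + d / 2 - t = d / 2); last by ring.
move=> /(_ isT); rewrite gtr0_norm ?divr_gt0// => /(_ _)/wrap[].
  by rewrite ltr_pdivrMr// ltr_pMr// ltr1n.
have q0 : 0 <= (f (t + d / 2) - f t) / (d / 2).
  by rewrite divr_ge0 ?divr_ge0 ?subr_ge0 ?ndf ?(ltW d0) ?(ltW st).
set q := _ / _ in q0 *; move=> /(le_lt_trans (ler_norm _)); lra.
Qed.

(** The difference [f - g] has zero slopes along the coincidence set [E]. *)
Lemma is_derive_limit_point_eq f g t D D' (E : set R) :
  (forall s, E s -> f s = g s) -> E t -> limit_point E t ->
  is_derive t 1 f D -> is_derive t 1 g D' -> D = D'.
Proof.
move=> Efg Et Elim df dg; apply/eqP; rewrite -subr_eq0 -normr_eq0.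
rewrite eq_le normr_ge0 andbT; apply/ler_addgt0Pr => e e0; rewrite add0r.
have e20 : 0 < e / 2 by rewrite divr_gt0.
have [d1 d10 H1] := is_derive_quotient df e20.
have [d2 d20 H2] := is_derive_quotient dg e20.
have d0 : 0 < Num.min d1 d2 by rewrite lt_min d10.
have [s [st Es]] := Elim (ball t (Num.min d1 d2)) (nbhsx_ballx _ _ d0).
rewrite /ball/= distrC lt_min => /andP[sd1 sd2].
have := H1 _ st sd1; have := H2 _ st sd2; rewrite (Efg _ Es) (Efg _ Et).
set q := _ / _ => q2 q1; rewrite (_ : D - D' = (q - D') - (q - D)); last by ring.
by rewrite (le_trans (ler_normB _ _))//; lra.
Qed.

End derivatives.

Section limit_of_primitives.
Context {R : realType}.
Notation mu := (@lebesgue_measure R).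
Notation integrable g := (mu.-integrable setT (EFin \o g)).
Implicit Types (g M x : R -> R) (s t : R).

Lemma integrable_dominated g M : measurable_fun setT g -> integrable M ->
  (forall t, `|g t| <= M t) -> integrable g.
Proof.
move=> mg iM gM; apply: le_integrable iM => //; first exact/measurable_EFinP.
by move=> t _ /=; rewrite lee_fin (le_trans (gM t))// ler_norm.
Qed.

(** The increments of [x] are limits of integrals of the [g_ k], so they are at
    most those of the primitive of [G m = sup_(k >= m) g_ k]; differentiating,
    [g <= G m] a.e. for every [m]. This is the bound [g <= limsup g_ k]. *)
Lemma ae_le_eventual_bound g M (g_ : nat -> R -> R) (x : R -> R) :
  integrable g -> integrable M ->
  (forall k, measurable_fun setT (g_ k)) ->
  (forall k t, `|g_ k t| <= M t) ->
  (forall t, prim (g_ k) t @[k --> \oo] --> x t) ->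
  (forall s t, s <= t -> x t - x s = prim g t - prim g s) ->
  {ae mu, forall t (c : R), (\forall k \near \oo, g_ k t <= c) -> g t <= c}.
Proof.
move=> ig iM mg gM gx xg.
pose G m t := sups (g_ ^~ t) m.
have ubg t : has_ubound (range (g_ ^~ t)).
  by exists (M t) => _ [k _ <-]; rewrite (le_trans (ler_norm _)).
have gG m k t : (m <= k)%N -> g_ k t <= G m t.
  by move=> mk; apply: ub_le_sup; [exact: has_ubound_sdrop|exists k].
have G_le m t c : (forall k, (m <= k)%N -> g_ k t <= c) -> G m t <= c.
  move=> H; apply: ge_sup; first by exists (g_ m t), m => /=.
  by move=> _ [k /= mk <-]; exact: H.
have GM m t : `|G m t| <= M t.
  rewrite ler_norml (le_trans _ (gG m m t (leqnn _))) ?G_le//.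
    by move=> k _; rewrite (le_trans (ler_norm _)).
  by have := gM m t; rewrite ler_norml => /andP[].
have iG m : integrable (G m).
  apply: (integrable_dominated _ iM (GM m)).
  by apply: measurable_fun_sups => // t _; exact: ubg.
have igk k : integrable (g_ k) by exact: (integrable_dominated _ iM (gM k)).
have ndG m : {homo (fun t => prim (G m) t - prim g t) : s t / s <= t}.
  move=> s t st; suff : prim g t - prim g s <= prim (G m) t - prim (G m) s by lra.
  rewrite -xg//; apply: (cvgr_to_le (cvgB (gx t) (gx s))).
  exists m => // k /= mk; apply: prim_le => // r; exact: gG.
have H m : {ae mu, forall t, g t <= G m t}.
  have := prim_ae_derive (iG m); have := prim_ae_derive ig.
  apply: filterS2 => t dg dG.
  by have := is_derive_homo_ge0 (ndG m) (is_deriveB dG dg); rewrite subr_ge0.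
have := ae_foralln H; apply: filterS => t Ht c [m _ mc].
by apply: le_trans (Ht m) _; apply: G_le => k mk; exact: mc.
Qed.

(** The bounds say [liminf g_ k t <= D <= limsup g_ k t]. As the [g_ k] may
    oscillate, the slope of the limit may lie strictly between the two. *)
Lemma ae_derive_limit_of_primitives M (g_ : nat -> R -> R) (x : R -> R) :
  integrable M -> (forall t, 0 <= M t) ->
  (forall k, measurable_fun setT (g_ k)) ->
  (forall k t, `|g_ k t| <= M t) ->
  (forall t, prim (g_ k) t @[k --> \oo] --> x t) ->
  {ae mu, forall t, exists D : R,
    [/\ is_derive t 1 x D,
        forall c : R, (\forall k \near \oo, g_ k t <= c) -> D <= c &
        forall c : R, (\forall k \near \oo, c <= g_ k t) -> c <= D]}.
Proof.
move=> iM M0 mg gM gx.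
have igk k : integrable (g_ k) by exact: (integrable_dominated _ iM (gM k)).
have xM s t : s <= t -> `|x t - x s| <= prim M t - prim M s.
  move=> st; apply: (cvgr_to_le (cvg_norm (cvgB (gx t) (gx s)))).
  by apply: nearW => k; exact: prim_dominated.
have [g ig xg] := dominated_is_primitive iM M0 xM.
have up := ae_le_eventual_bound ig iM mg gM gx xg.
have := @ae_le_eventual_bound (\- g) M (fun k => \- g_ k) (\- x).
have NgM k t : `|(\- g_ k) t| <= M t by rewrite /= normrN.
have Ngx t : prim (\- g_ k) t @[k --> \oo] --> (\- x) t.
  by under eq_fun do rewrite primN//; exact: cvgN.
have Nxg s t : s <= t -> (\- x) t - (\- x) s = prim (\- g) t - prim (\- g) s.
  by move=> st; rewrite !primN//=; have := xg _ _ st; lra.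
move=> /(_ (integrableN_EFin ig) iM (fun k => measurable_funN (mg k)) NgM Ngx Nxg) lo.
have xE : x = prim g \+ cst (x 0 - prim g 0).
  apply/funext => t /=; have [/xg|/ltW/xg] := leP 0 t; lra.
have dg := prim_ae_derive ig.
move: up lo dg; apply: filterS3 => t upt lot dgt.
exists (g t); split => //.
  by rewrite xE -[g t]addr0; apply: is_deriveD.
move=> c Hc; rewrite -lerN2; apply: lot; apply: filterS Hc => k /=.
by rewrite lerN2.
Qed.

End limit_of_primitives.

(** * A pointwise compactness principle *)

Section selection.
Context {R : realType}.
Implicit Types (s t r : R).

Let T (_ : R) : topologicalType := R.

Lemma prod_topology_nbhs_finite (p : prod_topology T) (l : seq R)
  (e : R) : 0 < e -> nbhs p [set f | forall r, r \in l -> `|p r - f r| < e].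
Proof.
move=> e0; elim: l => [|r l ih].
  rewrite (_ : mkset _ = setT); first exact: (@filterT _ _ (nbhs_filter p)).
  by apply/seteqP; split.
have pr := @proj_continuous R T r p.
have Br : nbhs (p r) (ball (p r) e) by exact: nbhsx_ballx.
have := @filterI _ _ (nbhs_filter p) _ _ (pr _ Br) ih.
apply: (@filterS _ _ (nbhs_filter p)) => f [fr fl] q.
by rewrite inE => /predU1P[->//|]; exact: fl.
Qed.

(** Tychonoff: a bounded sequence of functions has a cluster point in the
    product topology, that is, for approximation at finitely many points. *)
Lemma bounded_cluster (x_ : nat -> R -> R) (C : R) :
  (forall k t, `|x_ k t| <= C) ->
  exists x : R -> R, forall K (l : seq R) (e : R), 0 < e ->
    exists2 k, (K <= k)%N & forall r, r \in l -> `|x r - x_ k r| < e.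
Proof.
move=> xC; pose X : nat -> prod_topology T := x_.
have cK := @tychonoff R T (fun _ => `[- C, C]%classic)
  (fun _ => @segment_compact R (- C) C).
have FX : (X @ \oo) [set f | forall t, `[- C, C]%classic (f t)].
  by exists 0%N => // k _ t /=; rewrite in_itv/= -ler_norml.
have [x [_ xcl]] := cK (X @ \oo) _ FX.
exists x => K l e e0.
have [_ [[k Kk <-] H]] := xcl [set f | exists2 k, (K <= k)%N & X k = f] _
  (ltac:(by exists K => // k /= Kk; exists k)) (prod_topology_nbhs_finite x l e0).
by exists k.
Qed.

(** The subsequence is chosen so that its [j]-th term is close to a cluster
    point at the first [j] rationals; the common modulus of continuity then
    spreads the convergence to every point. *)
Lemma pointwise_convergent_subsequence (x_ : nat -> R -> R) (P : R -> R) (C : R) :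
  continuous P -> (forall k t, `|x_ k t| <= C) ->
  (forall k s t, `|x_ k t - x_ k s| <= `|P t - P s|) ->
  exists (phi : nat -> nat) (x : R -> R), (forall j, (j <= phi j)%N) /\
    forall t, x_ (phi j) t @[j --> \oo] --> x t.
Proof.
move=> cP xC xP; have [x xcl] := bounded_cluster xC.
have {}xP' s t : `|x t - x s| <= `|P t - P s|.
  apply/ler_addgt0Pr => e e0; have e20 : 0 < e / 2 by rewrite divr_gt0.
  have [k _ H] := xcl 0%N [:: s; t] _ e20.
  have := H s; rewrite mem_head => /(_ isT) Hs.
  have := H t; rewrite !inE eqxx orbT => /(_ isT) Ht.
  have := xP k s t.
  rewrite (_ : x t - x s = (x t - x_ k t) - (x s - x_ k s) + (x_ k t - x_ k s)); last by ring.
  move=> Hk; apply: (le_trans (ler_normD _ _)).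
  by have := ler_normB (x t - x_ k t) (x s - x_ k s); lra.
pose q i : R := ratr (odflt 0%Q (unpickle i)).
have ex j : exists k, (j <= k)%N /\ forall i, (i < j)%N -> `|x (q i) - x_ k (q i)| < j.+1%:R^-1.
  have [|k jk H] := xcl j [seq q i | i <- iota 0 j] j.+1%:R^-1.
    by rewrite invr_gt0.
  by exists k; split => // i ij; apply: H; apply: map_f; rewrite mem_iota.
have [phi Hphi] := choice ex.
exists phi, x; split => [j|t]; first by have [] := Hphi j.
apply/cvgrPdist_lt => e e0; have e30 : 0 < e / 3 by rewrite divr_gt0.
have /cvgrPdist_lt/(_ _ e30) := cP t.
rewrite -nbhs_nearE => /nbhs_ballP[d /= d0 Hd].
have [p] := rat_in_itvoo (ltac:(by rewrite ltrDl) : t < t + d).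
rewrite in_itv/= => /andP[tp ptd].
have {}Hd : `|P t - P (ratr p)| < e / 3.
  by apply: Hd; rewrite /ball/= distrC gtr0_norm ?subr_gt0// ltrBlDl.
near=> j; have [_ /(_ (pickle p))] := Hphi j.
have -> : (pickle p < j)%N by near: j; exact: nbhs_infty_gt.
rewrite /q pickleK/= => /(_ isT).
have : j.+1%:R^-1 < e / 3 by near: j; exact: (near_infty_natSinv_lt (PosNum e30)).
have := xP (phi j) t (ratr p); have := xP' (ratr p) t.
rewrite (distrC (P (ratr p))).
set y := x_ (phi j).
rewrite (_ : x t - y t = (x t - x (ratr p)) + (x (ratr p) - y (ratr p))
  + (y (ratr p) - y t)); last by ring.
have := ler_normD (x t - x (ratr p) + (x (ratr p) - y (ratr p))) (y (ratr p) - y t).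
have := ler_normD (x t - x (ratr p)) (x (ratr p) - y (ratr p)).
move=> h1 h2 h3 h4 h5 h6; have {h5 h6} := lt_trans h6 h5.
by move: Hd h1 h2 h3 h4; lra.
Unshelve. all: by end_near. Qed.

End selection.

(** * Solutions of delayed equations *)

Section delay.
Context {R : realType}.
Notation mu := (@lebesgue_measure R).
Notation integrable g := (mu.-integrable setT (EFin \o g)).
Implicit Types (f g M x y z : R -> R) (s t : R).

Lemma prim_ae_eq f g t : measurable_fun setT f -> measurable_fun setT g ->
  {ae mu, forall s, s <= t -> f s = g s} -> prim f t = prim g t.
Proof.
move=> mf mg fg; rewrite /prim /Rintegral; congr fine; apply: ae_eq_integral => //.
- by apply/measurable_EFinP; exact: measurable_funTS.
- by apply/measurable_EFinP; exact: measurable_funTS.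
apply: filterS fg => s /= fgs; rewrite in_itv/= => st.
by rewrite fgs.
Qed.

Lemma prim_eq0 g t : (forall s, s <= t -> g s = 0) -> prim g t = 0.
Proof.
move=> g0; rewrite /prim (@eq_Rintegral _ _ _ _ _ (cst 0)).
  by rewrite /Rintegral integral0.
by move=> s; rewrite inE/= in_itv/= => /g0.
Qed.

(* [S y] stands for a Borel version of [f(., y(.))]; as such a version is only
   chosen up to null sets, [S] is causal merely almost everywhere. *)
Variables (S : (R -> R) -> R -> R) (M : R -> R) (a c0 : R).
Hypothesis iM : integrable M.
Hypothesis M0 : forall t, 0 <= M t.
Hypothesis Ma : forall t, t <= a -> M t = 0.
Hypothesis mS : forall y, continuous y -> measurable_fun setT (S y).
Hypothesis SM : forall y, continuous y -> forall t, `|S y t| <= M t.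
Hypothesis causalS : forall y z t, continuous y -> continuous z ->
  (forall s, s <= t -> y s = z s) ->
  {ae mu, forall s, s <= t -> S y s = S z s}.

Lemma continuous_superposition_prim y : continuous y -> continuous (prim (S y)).
Proof.
move=> cy; apply: (continuous_dominated iM M0) => s t st.
apply: prim_dominated => //; last exact: SM.
by apply: (integrable_dominated _ iM) => //; [exact: mS|exact: SM].
Qed.

(** The [j]-th Picard iterate of the delayed equation is already stationary on
    [t <= a + j h], so finitely many iterations reach [b]. *)
Lemma delayed_solution (b h : R) : 0 < h ->
  exists2 y, continuous y & forall t, t <= b -> y t = c0 + prim (S y) (t - h).
Proof.
move=> h0; pose step y t := c0 + prim (S y) (t - h).
have cstep y : continuous y -> continuous (step y).
  move=> cy t; apply: cvgD; first exact: cvg_cst.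
  apply: (@continuous_comp _ _ _ (fun t => t - h) (prim (S y))).
    by apply: cvgB; [exact: cvg_id|exact: cvg_cst].
  exact: continuous_superposition_prim.
pose z j := iter j step (cst c0).
have cz j : continuous (z j).
  by elim: j => [|j ih]; [move=> t; exact: cvg_cst|exact: cstep].
have zS j : forall t, t <= a + j%:R * h -> z j t = z j.+1 t.
  elim: j => [|j ih] t tj.
    rewrite /z /= /step prim_eq0 ?addr0// => s st.
    apply/eqP; rewrite -normr_le0 (le_trans (SM _ _)) ?Ma//; first exact: (cz 0).
    by rewrite (le_trans st)//; move: tj; lra.
  rewrite -[LHS]/(step (z j) t) -[RHS]/(step (z j.+1) t) /step; congr (_ + _).
  apply: prim_ae_eq; [exact: (mS (cz j))|exact: (mS (cz j.+1))|].
  apply: causalS; [exact: (cz j)|exact: (cz j.+1)|move=> s st; apply: ih].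
  by apply: (le_trans st); move: tj; rewrite -natr1; lra.
have [N bN] : exists N : nat, b <= a + N%:R * h.
  exists (Num.truncn ((b - a) / h)).+1.
  have := truncnS_gt ((b - a) / h); rewrite ltr_pdivrMr//; lra.
by exists (z N) => // t tb; rewrite zS// (le_trans tb).
Qed.

End delay.

(** * Slopes lying between the lower and upper limits of [F (Y j)] *)

Section limit_slope.
Context {R : realType}.
Variables (F : R -> R) (Y : nat -> R) (z D : R).
Hypothesis Yz : Y j @[j --> \oo] --> z.
Hypothesis Dle : forall c : R, (\forall j \near \oo, F (Y j) <= c) -> D <= c.
Hypothesis leD : forall c : R, (\forall j \near \oo, c <= F (Y j)) -> c <= D.

Lemma slope_at_continuity_point : {for z, continuous F} -> D = F z.
Proof.
move=> cF; have FY : F (Y j) @[j --> \oo] --> F z.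
  exact: (continuous_cvg _ cF Yz).
apply/eqP; rewrite eq_le; apply/andP; split; apply/ler_addgt0Pr => e e0.
  by apply: Dle; apply: cvgr_le FY _ _; rewrite ltrDl.
rewrite -lerBlDr; apply: leD; apply: cvgr_ge FY _ _; by rewrite gtrBl.
Qed.

Lemma near_sequence_in_itv (e : R) : 0 < e ->
  \forall j \near \oo, Y j \in `[z - e, z + e].
Proof.
move=> e0; have /cvgrPdist_le/(_ _ e0) := Yz; apply: filterS => j.
by rewrite ler_distlC in_itv.
Qed.

Lemma slope_ge (e c : R) : 0 < e ->
  (forall y, y \in `[z - e, z + e] -> c < F y) -> c <= D.
Proof.
move=> e0 H; apply: leD; apply: filterS (near_sequence_in_itv e0) => j Yj.
exact/ltW/H.
Qed.

Lemma slope_le (e c : R) : 0 < e ->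
  (forall y, y \in `[z - e, z + e] -> F y < c) -> D <= c.
Proof.
move=> e0 H; apply: Dle; apply: filterS (near_sequence_in_itv e0) => j Yj.
exact/ltW/H.
Qed.

End limit_slope.

(** * Borel versions of the superposition *)

Section superposition.
Context {R : realType}.
Notation mu := (@lebesgue_measure R).
Notation integrable g := (mu.-integrable setT (EFin \o g)).
Implicit Types (g M y : R -> R) (s t : R).

Lemma integrable_majorant (a b : R) (f : R -> R -> R) (M : R -> R) :
  L1 `[a, b] M -> ae_on `[a, b] (fun t => forall x, `|f t x| <= M t) ->
  exists N : R -> R, [/\ integrable N, forall t, 0 <= N t,
    forall t, t \notin `]a, b[ -> N t = 0 &
    {ae mu, forall t, t \in `]a, b[ -> forall x, `|f t x| <= N t}].
Proof.
move=> LM /ae_completed_borel fM.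
have [h [ih hM]] := L1_borel_version (measurable_itv _) LM.
pose N := (fun t => `|h t|) \_ `]a, b[%classic.
exists N; split.
- have : mu.-integrable `]a, b[%classic (EFin \o (fun t => `|h t|)).
    apply: (@integrableS _ _ _ _ setT) => //.
    by apply: eq_integrable (integrable_abse ih).
  rewrite integrable_mkcond//; apply: eq_integrable => // t _ /=.
  by rewrite /N !patchE; case: ifP.
- by move=> t; rewrite /N patchE; case: ifP.
- by move=> t tab; rewrite /N patchE memNset//; apply/negP.
- apply: filterS2 fM hM => t fM hM tab x.
  have tab' : `[a, b]%classic t by move: tab; rewrite /= !in_itv/= => /andP[/ltW -> /ltW ->].
  have -> : N t = `|M t| by rewrite /N patchE ifT ?inE// (hM tab').
  by rewrite (le_trans (fM tab' x))// ler_norm.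
Qed.

Lemma borel_superposition (a b : R) (f : R -> R -> R) (N y : R -> R) :
  integrable N -> (forall t, 0 <= N t) ->
  {ae mu, forall t, t \in `]a, b[ -> forall x, `|f t x| <= N t} ->
  lebesgue_measurable_fun `[a, b] (fun t => f t (y t)) ->
  exists g, [/\ measurable_fun setT g, forall t, `|g t| <= N t &
    {ae mu, forall t, t \in `]a, b[ -> g t = f t (y t)}].
Proof.
move=> iN N0 fN mf.
have [h [mh hf]] := lebesgue_measurable_borel_version (measurable_itv _) mf.
have mN : measurable_fun setT N by case/integrableP : iN => /measurable_EFinP.
(* Clipping makes the bound hold at every point and alters nothing where the
   bound already holds. *)
exists (fun t => Num.max (- N t) (Num.min (N t) (h t))); split.
- apply: measurable_maxr; first exact: measurable_funN.
  exact: measurable_minr.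
- move=> t; rewrite ler_norml le_max lexx/= ge_max ge_min lexx/= andbT.
  by rewrite (le_trans _ (N0 t))// oppr_le0.
- apply: filterS2 fN hf => t fN hf tab.
  have tab' : `[a, b]%classic t by move: tab; rewrite /= !in_itv/= => /andP[/ltW -> /ltW ->].
  rewrite (hf tab'); have := fN tab (y t); rewrite ler_norml => /andP[h1 h2].
  by rewrite min_r// max_r.
Qed.

Lemma prim_bounded g M t : measurable_fun setT g -> integrable M ->
  (forall t, `|g t| <= M t) -> `|prim g t| <= \int[mu]_r M r.
Proof.
move=> mg iM gM.
have ig := integrable_dominated mg iM gM.
have M0 r : 0 <= M r by exact: le_trans (gM r).
apply: (@le_trans _ _ (prim M t)).
  apply: (le_trans (le_normr_Rintegral _ _)) => //; first exact: integrableS ig.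
  apply: le_Rintegral => //; last exact: integrableS iM.
  apply: integrableS (integrable_abse ig) => //.
have mM : measurable_fun setT (EFin \o M) by case/integrableP : iM.
apply: fine_le; [|exact: integrable_fin_num|].
  by apply: integrable_fin_num => //; exact: integrableS iM.
by apply: ge0_subset_integral => // r _; rewrite lee_fin.
Qed.

End superposition.

(** * Contact with admissible discontinuity curves *)

Section contact.
Context {R : realType}.
Notation mu := (@lebesgue_measure R).
Implicit Types (s t : R).

Definition viable_at (f : R -> R -> R) (gamma : R -> R) t :=
  is_derive t 1 gamma (f t (gamma t)).

Definition inviable_at (f : R -> R -> R) (gamma : R -> R) t :=
  derivable gamma t 1 /\ exists eps psi : R, [/\ 0 < eps, 0 < psi &
    (forall y, y \in `[gamma t - eps, gamma t + eps] ->
      derive1 gamma t + psi < f t y) \/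
    (forall y, y \in `[gamma t - eps, gamma t + eps] ->
      f t y < derive1 gamma t - psi)].

Lemma ae_admissible_curve (a b c d : R) f gamma :
  admissible_curve a b f c d gamma ->
  {ae mu, forall t, t \in `[c, d] -> viable_at f gamma t \/ inviable_at f gamma t}.
Proof.
move=> [_ _ [/ae_completed_borel|[eps [psi [e0 _ /ae_completed_borel psi0 H]]]]].
  by apply: filterS => t H tcd; left; exact: H.
case: H => /ae_completed_borel H; apply: filterS2 psi0 H => t psi0 H tcd; right;
  have [dg Hy] := H tcd; split => //; exists eps, (psi t); split => //.
- exact: psi0.
- by left.
- exact: psi0.
- by right.
Qed.

(** The isolated points of a set of reals are countably many. *)
Lemma ae_limit_point (A : set R) :
  {ae mu, forall t, A t -> limit_point A t}.
Proof.
have : mu.-negligible (isolated A).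
  exists (isolated A); split => //.
    by apply: countable_measurable => //; exact: countable_isolated.
  by rewrite countable_lebesgue_measure0//; exact: countable_isolated.
apply: negligibleS => t /= /not_implyP[At nlt].
have : closure A t by exact: subset_closure.
by rewrite closure_isolated_limit_point => -[].
Qed.

(** At a limit point of the contact set, [x] and [gamma] have the same
    derivative [D]. Inviability would push the values [f t (Y j)], hence the
    slope [D], strictly away from [gamma' t = D]. *)
Lemma slope_at_contact f gamma (x : R -> R) (Y : nat -> R) t (D : R) (A : set R) :
  (forall s, A s -> x s = gamma s) -> A t -> limit_point A t ->
  viable_at f gamma t \/ inviable_at f gamma t ->
  is_derive t 1 x D ->
  Y j @[j --> \oo] --> x t ->
  (forall c : R, (\forall j \near \oo, f t (Y j) <= c) -> D <= c) ->
  (forall c : R, (\forall j \near \oo, c <= f t (Y j)) -> c <= D) ->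
  D = f t (x t).
Proof.
move=> xg At Alim + dx Yx Dle leD; rewrite (xg t At) => -[dg|[dg]].
  exact: is_derive_limit_point_eq xg At Alim dx dg.
have {}dg : is_derive t 1 gamma (derive1 gamma t).
  by rewrite derive1E; exact/derivableP.
have DE := is_derive_limit_point_eq xg At Alim dx dg.
rewrite DE (xg t At) in Yx Dle leD *.
move=> [eps [psi [e0 p0 [H|H]]]]; exfalso.
  by have := slope_ge Yx leD e0 H; rewrite gerDl leNgt p0.
by have := slope_le Yx Dle e0 H; rewrite lerBrDl gerDr leNgt p0.
Qed.

End contact.

(** * Existence of a solution *)

Theorem theorem5p5 (R : realType) (a b xa : R) (f : R -> R -> R)
  (ab : a < b)
  (H1 : exists M : R -> R,
      [/\ forall t, t \in `[a, b] -> 0 <= M t,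
          L1 `[a, b] M &
          ae_on `[a, b] (fun t => forall x, `|f t x| <= M t)])
  (H2 : forall x : R -> R, {within `[a, b], continuous x} ->
      lebesgue_measurable_fun `[a, b] (fun t => f t (x t)))
  (H3 : exists (an bn : nat -> R) (gamma : nat -> R -> R),
      (forall n, admissible_curve a b f (an n) (bn n) (gamma n)) /\
      ae_on `[a, b] (fun t => forall x : R,
        (forall n, t \in `[an n, bn n] -> x <> gamma n t) ->
        {for x, continuous (f t)})) :
  exists x : R -> R,
    [/\ absolutely_continuous a b x,
        caratheodory_solution f a b x &
        x a = xa].
Proof.
have [M [M0 LM fM]] := H1.
have [N [iN N0 Nout fN]] := integrable_majorant LM fM.
(* Continuity of [y] is kept as an implication inside the existential so that
   the choice function [S] is defined on all functions. *)
have exS y : exists g : R -> R, continuous y ->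
    [/\ measurable_fun setT g, forall t, `|g t| <= N t &
    {ae @lebesgue_measure R, forall t, t \in `]a, b[ -> g t = f t (y t)}].
  have [cy|ncy] := pselect (continuous y); last by exists (cst 0).
  have [|g Hg] := @borel_superposition R a b f N y iN N0 fN.
    by apply: H2; exact: continuous_subspaceT.
  by exists g.
have [S HS] := choice exS.
have mS y : continuous y -> measurable_fun setT (S y) by move=> /HS[].
have SN y : continuous y -> forall t, `|S y t| <= N t by move=> /HS[].
have Sf y : continuous y ->
    {ae @lebesgue_measure R, forall t, t \in `]a, b[ -> S y t = f t (y t)}.
  by move=> /HS[].
have Sout y t : continuous y -> t \notin `]a, b[ -> S y t = 0.
  move=> cy tab; apply/eqP; rewrite -normr_le0.
  by rewrite (le_trans (SN _ cy t))// Nout.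
have causal y z t : continuous y -> continuous z ->
    (forall s, s <= t -> y s = z s) ->
    {ae @lebesgue_measure R, forall s, s <= t -> S y s = S z s}.
  move=> cy cz yz; apply: filterS2 (Sf _ cy) (Sf _ cz) => s ys zs st.
  have [sab|sab] := boolP (s \in `]a, b[); last by rewrite !Sout.
  by rewrite ys// zs// yz.
have outa t : t <= a -> t \notin `]a, b[ by move=> ta; rewrite in_itv/= ltNge ta.
have Na t : t <= a -> N t = 0 by move=> /outa; exact: Nout.
have exY k : exists y : R -> R, continuous y /\
    forall t, t <= b -> y t = xa + prim (S y) (t - k.+1%:R^-1).
  have [|y cy yE] := @delayed_solution R S N a xa iN N0 Na mS SN causal b k.+1%:R^-1.
    by rewrite invr_gt0.
  by exists y.
have [y Hy] := choice exY.
have cy k : continuous (y k) by have [] := Hy k.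
have yE k t : t <= b -> y k t = xa + prim (S (y k)) (t - k.+1%:R^-1).
  by have [_] := Hy k; exact.
have N_norm t : `|N t| <= N t by rewrite ger0_norm.
have iS k : (@lebesgue_measure R).-integrable setT (EFin \o S (y k)).
  exact: integrable_dominated (mS _ (cy k)) iN (SN _ (cy k)).
have cN : continuous (prim N).
  by apply: (continuous_dominated iN N0) => s t st; exact: prim_dominated.
have Sdist k s t : `|prim (S (y k)) t - prim (S (y k)) s| <= `|prim N t - prim N s|.
  have [st|/ltW st] := leP s t.
    by rewrite (le_trans (prim_dominated (iS k) iN (SN _ (cy k)) st))// ler_norm.
  rewrite distrC (distrC (prim N t)).
  by rewrite (le_trans (prim_dominated (iS k) iN (SN _ (cy k)) st))// ler_norm.
have [phi [u [phij Su]]] := pointwise_convergent_subsequence cN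
  (fun k t => prim_bounded t (mS _ (cy k)) iN (SN _ (cy k))) Sdist.
have u_dist s t : s <= t -> `|(xa + u t) - (xa + u s)| <= prim N t - prim N s.
  move=> st; rewrite opprD addrACA subrr add0r.
  apply: (cvgr_to_le (cvg_norm (cvgB (Su t) (Su s)))).
  by apply: nearW => k; apply: prim_dominated => //; exact/SN/cy.
(* [y_k t] differs from [xa + prim (S y_k) t] by an integral over an interval
   of length [h_k = 1 / (k + 1)]. *)
have yu t : t <= b -> y (phi j) t @[j --> \oo] --> xa + u t.
  move=> tb; apply/cvgrPdist_lt => e e0; have e20 : 0 < e / 2 by rewrite divr_gt0.
  have [d d0 Hd] := prim_unif_continuous iN N0 e20.
  near=> j; rewrite yE//.
  have h1 : `|u t - prim (S (y (phi j))) t| < e / 2.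
    by near: j; move/cvgrPdist_lt : (Su t) => /(_ _ e20).
  have h2 : `|prim N t - prim N (t - (phi j).+1%:R^-1)| < e / 2.
    apply: Hd; rewrite opprB addrC subrK ger0_norm//.
    apply: (@le_lt_trans _ _ j.+1%:R^-1).
      by rewrite lef_pV2 ?posrE// ler_nat ltnS.
    by near: j; exact: (near_infty_natSinv_lt (PosNum d0)).
  have := Sdist (phi j) (t - (phi j).+1%:R^-1) t.
  set p := prim (S (y (phi j))) in h1 *; set t' := t - _ => h3.
  rewrite (_ : _ - _ = (u t - p t) + (p t - p t')); last by ring.
  by apply: (le_lt_trans (ler_normD _ _)); move: h1 h2 h3; lra.
have [an [bn [gamma [adm /ae_completed_borel fcont]]]] := H3.
pose E n : set R := [set t | t \in `[an n, bn n] /\ xa + u t = gamma n t].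
exists (fun t => xa + u t); split.
- exact: absolutely_continuous_dominated iN N0 u_dist.
- apply/ae_completed_borel.
  have A1 := ae_derive_limit_of_primitives iN N0 (fun j => mS _ (cy (phi j)))
    (fun j => SN _ (cy (phi j))) Su.
  have A2 := ae_foralln (fun j => Sf _ (cy (phi j))).
  have A3 := ae_foralln (fun n => ae_admissible_curve (adm n)).
  have A4 := ae_foralln (fun n => ae_limit_point (E n)).
  have A5 : {ae @lebesgue_measure R, forall t, t \in `[a, b] -> t \in `]a, b[}.
    have cab : countable [set a; b].
      by apply: finite_set_countable; rewrite finite_setU; split; exact: finite_set1.
    exists [set a; b]; split.
    + exact: countable_measurable.
    + exact: countable_lebesgue_measure0.
    + move=> t /= /not_implyP[]; rewrite !in_itv/= => /andP[at_ tb] /negP.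
      rewrite negb_and -!leNgt => /orP[ta|bt]; [left|right].
        by apply/eqP; rewrite eq_le ta.
      by apply/eqP; rewrite eq_le tb.
  near=> t => tab; have [|D [du Dle leD]] := near A1 t; first by [].
  have gE := near A2 t _; have admt := near A3 t _; have limt := near A4 t _.
  have tab' : t \in `]a, b[ by exact: (near A5 t _ tab).
  have ft := near fcont t _ tab; have tb : t <= b by case/andP: tab.
  have dx : is_derive t 1 (fun t => xa + u t) D.
    by rewrite -[D]add0r; exact: is_deriveD.
  have {}gE j : S (y (phi j)) t = f t (y (phi j) t) by exact: gE.
  have {}Dle c : (\forall j \near \oo, f t (y (phi j) t) <= c) -> D <= c.
    by move=> H; apply: Dle; apply: filterS H => j; rewrite gE.
  have {}leD c : (\forall j \near \oo, c <= f t (y (phi j) t)) -> c <= D.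
    by move=> H; apply: leD; apply: filterS H => j; rewrite gE.
  suff <- : D = f t (xa + u t) by [].
  have [[n Ent]|nE] := pselect (exists n, E n t).
    apply: (slope_at_contact (gamma := gamma n) (A := E n)
      (Y := fun j => y (phi j) t)) => //.
    - by move=> s [].
    - exact: limt.
    - by apply: admt; case: Ent.
    - exact: yu.
  apply: (slope_at_continuity_point (yu t tb) Dle leD); apply: ft => // n tn xg.
  by apply: nE; exists n.
- suff -> : u a = 0 by rewrite addr0.
  have S0 j : prim (S (y (phi j))) a = 0.
    by apply: prim_eq0 => s sa; exact/Sout/outa.
  have := Su a; under eq_fun do rewrite S0.
  by move=> /(cvg_unique (@Rhausdorff R)); apply; exact: cvg_cst.
Unshelve. all: by end_near. Qed.
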